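(* Let $\mathbb{F}_{3^{97}} = \mathbb{F}_3[x]/(x^{97}+x^{16}+2)$, let $\mathbb{F}_{3^{2\cdot 97}} = \mathbb{F}_{3^{97}}[y]/(y^2+1)$ with $s \in \mathbb{F}_{3^{2\cdot 97}}$ a root of $y^2+1$, and let $\mathbb{F}_{3^{6\cdot 97}} = \mathbb{F}_{3^{2\cdot 97}}[z]/(z^3-z-1)$ with $r \in \mathbb{F}_{3^{6\cdot 97}}$ a root of $z^3-z-1$. Let $\alpha, \beta \in \mathbb{F}_{3^{6\cdot 97}}$ be given as $$\alpha = a_0+a_1s+a_2r+a_3rs+a_4r^2+a_5r^2s, \qquad \beta = b_0+b_1s+b_2r+b_3rs+b_4r^2+b_5r^2s,$$ with $a_0,\dots,a_5,b_0,\dots,b_5 \in \mathbb{F}_{3^{97}}$, and let their product $\gamma=\alpha\beta \in \mathbb{F}_{3^{6\cdot 97}}$ be $$\gamma = c_0+c_1s+c_2r+c_3rs+c_4r^2+c_5r^2s, \qquad c_0,\dots,c_5\in\mathbb{F}_{3^{97}}.$$ Then the coefficients $c_0,\dots,c_5$ can be computed from $a_0,\dots,a_5,b_0,\dots,b_5$ using only $15$ multiplications in $\mathbb{F}_{3^{97}}$; that is, there is a straight-line computation over $\mathbb{F}_{3^{97}}$, the same for all $\alpha,\beta$, which takes $a_0,\dots,a_5,b_0,\dots,b_5$ as inputs, outputs $c_0,\dots,c_5$, and uses at most $15$ multiplications.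
   Context: The family $1, s, r, rs, r^2, r^2s$ is a basis of $\mathbb{F}_{3^{6\cdot 97}}$ over $\mathbb{F}_{3^{97}}$, so $a_i$, $b_i$, $c_i$ are the coordinates of $\alpha$, $\beta$, $\gamma$ in this basis. Counting convention: a straight-line computation over $\mathbb{F}_{3^{97}}$ is a fixed finite sequence of steps, independent of the input values. Each step produces an element of $\mathbb{F}_{3^{97}}$ from the inputs and from previously computed elements, and is either an addition, a subtraction, a negation (equivalently, multiplication by the constant $2=-1\in\mathbb{F}_3$), or a multiplication of two elements. Only the steps of the last kind, multiplications of two elements of $\mathbb{F}_{3^{97}}$, are counted; additions, subtractions and negations are free. Outputs are designated inputs or computed elements. *)

(* Defs.v *)
From HB Require Import structures.
From mathcomp Require Import all_boot all_order all_fingroup all_algebra all_field ring.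

Set Implicit Arguments.
Unset Strict Implicit.
Unset Printing Implicit Defensive.

Import GRing.Theory.
Local Open Scope ring_scope.

(* Irreducibility of X^97 + X^16 + 2 over 'F_3: if sigma is the Frobenius of
   'F_3[X]/(g), g an irreducible divisor of degree d < 97, then both sigma^d and
   sigma^97 fix the class of X, hence so does sigma, since d is prime to 97.
   That sigma^97 fixes X is checked by computation on coefficient lists (low
   degree first, entries mod 3). *)

Section Eval.
Variables (L : nzRingType) (x : L).

Fixpoint eval3 (s : seq nat) : L :=
  if s is c :: s' then c%:R + x * eval3 s' else 0.

Lemma eval3_cat s t : eval3 (s ++ t) = eval3 s + x ^+ size s * eval3 t.
Proof.
elim: s => [|c s IH] /=; first by rewrite add0r mul1r.
by rewrite IH mulrDr addrA mulrA -exprS.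
Qed.

Lemma eval3_nseq0 n : eval3 (nseq n 0) = 0.
Proof. by elim: n => //= n ->; rewrite mulr0 addr0. Qed.
End Eval.

Fixpoint add3 (s t : seq nat) : seq nat :=
  match s, t with
  | [::], _ => t
  | _, [::] => s
  | a :: s', b :: t' => ((a + b) %% 3)%N :: add3 s' t'
  end.

Fixpoint cube3 (s : seq nat) : seq nat :=
  if s is c :: s' then [:: c, 0, 0 & cube3 s']%N else [::].

Definition reduce3 (s : seq nat) : seq nat :=
  let lo := take 97 s in let hi := drop 97 s in
  if hi is [::] then s
  else add3 lo (add3 hi (nseq 16 0%N ++ add3 hi hi)).

Definition frob3 (s : seq nat) : seq nat := iter 3 reduce3 (cube3 s).

Section Trinomial.
Variables (L : fieldType) (x : L).
Hypothesis L3 : 3 \in [pchar L].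
Hypothesis x_root : x ^+ 97 = 1 + x ^+ 16 *+ 2.

Let three0 : 3%:R = 0 :> L. Proof. exact: pcharf0 L3. Qed.

Lemma eval3_add s t : eval3 x (add3 s t) = eval3 x s + eval3 x t.
Proof.
elim: s t => [|a s IH] [|b t] /=; rewrite ?addr0 ?add0r // IH.
have -> : (((a + b) %% 3)%N%:R : L) = a%:R + b%:R.
  by rewrite -natrD [in RHS](divn_eq (a + b) 3) natrD natrM three0 mulr0 add0r.
by rewrite mulrDr addrACA.
Qed.

Lemma eval3_cube s : eval3 x (cube3 s) = eval3 x s ^+ 3.
Proof.
elim: s => [|c s IH]; first by rewrite /= expr0n.
rewrite [LHS]/= [eval3 x (c :: s)]/= IH !add0r -[RHS](pFrobenius_autE L3).
rewrite rmorphD rmorph_nat rmorphM /= !(pFrobenius_autE L3).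
by rewrite [x ^+ 3]exprS expr2 !mulrA.
Qed.

Lemma eval3_reduce s : eval3 x (reduce3 s) = eval3 x s.
Proof.
rewrite /reduce3; case E: (drop 97 s) => [//|c t]; rewrite -E.
have ls : (97 < size s)%N.
  by rewrite ltnNge; apply/negP => h; rewrite drop_oversize in E.
rewrite -[in RHS](cat_take_drop 97 s) eval3_cat size_takel ?(ltnW ls) //.
rewrite !eval3_add eval3_cat eval3_nseq0 eval3_add size_nseq add0r.
set h := eval3 x (drop _ _); congr (_ + _).
rewrite x_root.
by rewrite mulrDl mul1r mulrnAl -mulr2n mulrnAr.
Qed.

Lemma eval3_frob s : eval3 x (frob3 s) = eval3 x s ^+ 3.
Proof. by rewrite /frob3 /= !eval3_reduce eval3_cube. Qed.

Lemma frob_trinomial : iter 97 (fun y : L => y ^+ 3) x = x.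
Proof.
have ev : eval3 x [:: 0; 1]%N = x by rewrite /= add0r mulr0 addr0 mulr1.
have H n : iter n (fun y : L => y ^+ 3) x = eval3 x (iter n frob3 [:: 0; 1]%N).
  by elim: n => [|n IH]; rewrite ?ev // !iterS IH eval3_frob.
rewrite H.
have -> : iter 97 frob3 [:: 0; 1]%N = [:: 0; 1]%N ++ nseq 95 0%N.
  by vm_compute.
by rewrite eval3_cat eval3_nseq0 mulr0 addr0 ev.
Qed.
End Trinomial.

Lemma iter_cube_id (L : fieldType) (x : L) (m n : nat) :
  (0 < m)%N -> coprime m n ->
  iter m (fun y : L => y ^+ 3) x = x -> iter n (fun y : L => y ^+ 3) x = x ->
  x ^+ 3 = x.
Proof.
set f := fun y : L => _ => m0 co fm fn.
have fM k l : iter k f x = x -> iter (l * k) f x = x.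
  by move=> fk; elim: l => // l IH; rewrite mulSn iterD IH.
have [u v e _] := egcdnP n m0.
have := fM m u fm; rewrite e (eqP co) addn1 iterS.
by rewrite (fM n v fn).
Qed.

Lemma trinomial_no_root (L : fieldType) (x : L) :
  3 \in [pchar L] -> x ^+ 3 = x -> x ^+ 97 = 1 + x ^+ 16 *+ 2 -> False.
Proof.
move=> L3 x3; have three0 : 3%:R = 0 :> L by exact: pcharf0 L3.
have x2n n : x ^+ (n.*2).+1 = x.
  elim: n => [//|n IH]; rewrite doubleS exprS exprS IH -[RHS]x3.
  by rewrite exprS expr2.
have -> : x ^+ 97 = x by rewrite -[in RHS](x2n 48).
have -> : x ^+ 16 = x ^+ 2 by rewrite exprS (x2n 7).
move=> xe; have xx : x ^+ 2 = 0.
  have : x * x = x * (1 + x ^+ 2 *+ 2) by rewrite -xe.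
  rewrite mulrDr mulr1 mulrnAr -exprS x3 -expr2 -mulrS => ->.
  by rewrite -mulr_natr three0 mulr0.
have x0 : x = 0 by rewrite -x3 exprS xx mulr0.
by move/eqP: xe; rewrite x0 expr0n mul0rn addr0 eq_sym oner_eq0.
Qed.

Lemma iter_cube (L : nzRingType) (x : L) n :
  iter n (fun y : L => y ^+ 3) x = x ^+ (3 ^ n).
Proof. by elim: n => [|n IH] /=; rewrite ?expr1 // IH -exprM -expnSr. Qed.

Lemma monic_irreducible_divisor (F : finFieldType) (q : {poly F}) :
  (1 < size q)%N ->
  exists g : {poly F}, inhabited (monic_irreducible_poly g) /\ g %| q.
Proof.
have [n] := ubnP (size q); elim: n q => // n IH q; rewrite ltnS => qn q1.
have q0 : q != 0 by rewrite -size_poly_gt0 ltnW.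
have lq0 : (lead_coef q)^-1 != 0 by rewrite invr_eq0 lead_coef_eq0.
have [/irreducibleP qi|] := boolP (irreducibleb q).
  exists ((lead_coef q)^-1 *: q); split; last by rewrite dvdpZl.
  split; split; last first.
    by rewrite monicE lead_coefZ mulVf // lead_coef_eq0.
  split=> [|d d1]; first by rewrite size_scale.
  rewrite dvdpZr // => dq.
  by rewrite (eqp_trans (qi.2 d d1 dq)) // eqp_sym eqp_scale.
rewrite /irreducibleb q1 /= negb_forall => /existsP[d].
rewrite negb_imply -ltnNge -Pdiv.Idomain.dvdpE => /andP[dq d1].
have dn : (size d < n)%N.
  apply: leq_trans qn; apply: leq_ltn_trans (size_npoly d) _.
  by rewrite prednK // ltnW.
have [g [gi gd]] := IH _ dn d1.
by exists g; split=> //; apply: dvdp_trans dq.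
Qed.

Lemma char3_solve (R : comNzRingType) (a b : R) :
  3%:R = 0 :> R -> a + b + 2%:R = 0 -> a = 1 + b *+ 2.
Proof.
move=> three0 e.
have -> : a = (a + b + 2%:R) + (1 + b *+ 2) - 3%:R * (b + 1) by ring.
by rewrite e three0 mul0r add0r subr0.
Qed.

Definition trinomial97 : {poly 'F_3} := 'X^97 + 'X^16 + 2%:P.

Lemma size_trinomial97 : size trinomial97 = 98.
Proof.
rewrite /trinomial97 -addrA size_polyDl size_polyXn //.
rewrite (leq_ltn_trans (size_polyD _ _)) // size_polyXn gtn_max /=.
exact: leq_ltn_trans (size_polyC_leq1 _) _.
Qed.

Lemma monic_trinomial97 : trinomial97 \is monic.
Proof.
rewrite monicE lead_coefE size_trinomial97 /trinomial97 /=.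
by rewrite !coefD !coefXn coefC /= !addr0.
Qed.

Lemma trinomial97_mi : monic_irreducible_poly trinomial97.
Proof.
split; last exact: monic_trinomial97.
split=> [|q q1 qf]; first by rewrite size_trinomial97.
have f0 : trinomial97 != 0 by rewrite -size_poly_gt0 size_trinomial97.
have q0 : q != 0 by apply: contraTneq qf => ->; rewrite dvd0p.
have qgt1 : (1 < size q)%N by rewrite ltn_neqAle eq_sym q1 size_poly_gt0.
have [g [[gmi] gq]] := monic_irreducible_divisor qgt1.
have gf := dvdp_trans gq qf.
have le_qf := dvdp_leq f0 qf; have le_gq := dvdp_leq q0 gq.
have [lt_gf|ge_gf] := ltnP (size g) (size trinomial97); last first.
  by rewrite -dvdp_size_eqp // eqn_leq le_qf (leq_trans ge_gf).
exfalso; pose L := {poly %/ g with gmi}.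
pose ev : {rmorphism {poly 'F_3} -> {poly %/ g}} := in_qpoly g.
pose x : L := ev 'X.
have L3 : 3 \in [pchar L] by rewrite (pchar_lalg L) pchar_Fp.
have xe : x ^+ 97 = 1 + x ^+ 16 *+ 2.
  have f_x : ev trinomial97 = 0.
    apply/val_inj; rewrite /= mk_monicE //; apply/Pdiv.CommonRing.rmodp_eq0P.
    by rewrite -Pdiv.Idomain.dvdpE.
  have three0 : 3%:R = 0 :> {poly %/ g} by exact: (pcharf0 L3).
  have e2 : ev 2%:P = 2%:R by rewrite polyC_natr rmorph_nat.
  apply: char3_solve => //.
  have <- : ev trinomial97 = x ^+ 97 + x ^+ 16 + 2%:R; last exact: f_x.
  by rewrite -e2 /trinomial97 rmorphD [ev ('X^97 + _)]rmorphD (rmorphXn ev 97) (rmorphXn ev 16).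
pose d := (size g).-1.
have g_gt1 : (1 < size g)%N by exact: gmi.1.1.
have d0 : (0 < d)%N by rewrite /d -subn1 subn_gt0.
have d97 : (d < 97)%N.
  rewrite -ltnS /d prednK ?(ltnW g_gt1) //.
  by move: lt_gf; rewrite size_trinomial97.
have co : coprime d 97.
  by rewrite coprime_sym prime_coprime // gtnNdvd.
have fd : iter d (fun y : L => y ^+ 3) x = x.
  have cL : #|L| = (3 ^ d)%N by rewrite card_qfpoly card_Fp.
  by rewrite iter_cube -cL expf_card.
have x3 := iter_cube_id d0 co fd (frob_trinomial L3 xe).
exact: trinomial_no_root L3 x3 xe.
Qed.

Definition F3_97 : predArgType := {poly %/ trinomial97 with trinomial97_mi}.
HB.instance Definition _ := FinRing.Field.on F3_97.

Lemma card_F3_97 : #|F3_97| = (3 ^ 97)%N.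
Proof. by rewrite card_qfpoly card_Fp // size_trinomial97. Qed.

Lemma quadratic_mi (F : finFieldType) n :
  #|F| = (3 ^ n)%N -> odd n -> monic_irreducible_poly ('X^2 + 1 : {poly F}).
Proof.
move=> cF on.
have sz : size ('X^2 + 1 : {poly F}) = 3.
  by rewrite size_polyDl size_polyXn // size_poly1.
split; last by rewrite monicE lead_coefE sz coefD coefXn coef1 addr0.
apply: cubic_irreducible => [|x]; rewrite ?sz //; apply/negP => /rootP.
rewrite !hornerE => /eqP; rewrite addr_eq0 => /eqP x2.
have F3 : 3 \in [pchar F] by apply: card_finPcharP cF _.
have three0 : 3%:R = 0 :> F by exact: pcharf0 F3.
have x3 : x ^+ 3 = - x by rewrite exprS x2 mulrN1.
have it k : iter k (fun y : F => y ^+ 3) x = (-1) ^+ k * x.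
  elim: k => [|k IH]; first by rewrite mul1r.
  have s3 : (-1 : F) ^+ 3 = -1 by rewrite -signr_odd.
  by rewrite iterS IH exprMn x3 exprAC s3 exprS mulrN mulN1r mulNr.
have x0 : x = 0.
  have xN : x = - x.
    rewrite -{1}(expf_card x) cF -iter_cube it -signr_odd on expr1.
    exact: mulN1r.
  have : x *+ 3 = 0 by rewrite -mulr_natr three0 mulr0.
  by rewrite mulrS mulr2n {2}xN addNr addr0.
by move/eqP: x2; rewrite x0 expr0n eq_sym oppr_eq0 oner_eq0.
Qed.

Lemma cubic_mi (F : finFieldType) n :
  #|F| = (3 ^ n)%N -> ~~ (3 %| n)%N ->
  monic_irreducible_poly ('X^3 - 'X - 1 : {poly F}).
Proof.
move=> cF n3.
have le2 : (size (- 'X - 1 : {poly F})%R < 4)%N.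
  rewrite -opprD size_polyN (leq_ltn_trans (size_polyD _ _)) //.
  by rewrite size_polyX size_poly1.
have sz : size ('X^3 - 'X - 1 : {poly F}) = 4.
  by rewrite -addrA size_polyDl size_polyXn.
split; last first.
  by rewrite monicE lead_coefE sz !coefB coefXn coefX coef1 /= !subr0.
apply: cubic_irreducible => [|z]; rewrite ?sz //; apply/negP => /rootP.
rewrite !hornerE => /eqP; rewrite -addrA -opprD subr_eq0 => /eqP z3.
have F3 : 3 \in [pchar F] by apply: card_finPcharP cF _.
have it k : iter k (fun y : F => y ^+ 3) z = z + k%:R.
  elim: k => [|k IH]; first by rewrite addr0.
  rewrite iterS IH -(pFrobenius_autE F3) rmorphD rmorph_nat /= pFrobenius_autE.
  by rewrite z3 -addrA -mulrS.
move: (expf_card z); rewrite cF -iter_cube it -[RHS]addr0 => /addrI /eqP.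
by rewrite -(dvdn_pcharf F3) (negPf n3).
Qed.

Definition quadratic97 : {poly F3_97} := 'X^2 + 1.

Lemma quadratic97_mi : monic_irreducible_poly quadratic97.
Proof. exact: quadratic_mi card_F3_97 _. Qed.

Definition F3_194 : predArgType := {poly %/ quadratic97 with quadratic97_mi}.
HB.instance Definition _ := FinRing.Field.on F3_194.

Lemma card_F3_194 : #|F3_194| = (3 ^ 194)%N.
Proof.
rewrite card_qfpoly size_polyDl size_polyXn ?size_poly1 //.
by rewrite card_F3_97 -expnM.
Qed.

Definition cubic194 : {poly F3_194} := 'X^3 - 'X - 1.

Lemma cubic194_mi : monic_irreducible_poly cubic194.
Proof. exact: cubic_mi card_F3_194 _. Qed.

Definition F3_582 : predArgType := {poly %/ cubic194 with cubic194_mi}.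
HB.instance Definition _ := FinRing.Field.on F3_582.

Definition incl2 : F3_97 -> F3_194 := qfpoly_const quadratic97_mi.
Definition incl6 : F3_194 -> F3_582 := qfpoly_const cubic194_mi.

Definition comb6 (s : F3_194) (r : F3_582) (a : 6.-tuple F3_97) : F3_582 :=
  let k x := incl6 (incl2 x) in
  k a`_0 + k a`_1 * incl6 s + k a`_2 * r + k a`_3 * (r * incl6 s)
    + k a`_4 * r ^+ 2 + k a`_5 * (r ^+ 2 * incl6 s).

(* Operands are positions in a memory which initially holds the inputs and to
   which every step appends its result. There are no constants. *)
Inductive step : Type :=
  | Add of nat & nat
  | Sub of nat & nat
  | Neg of nat
  | Mul of nat & nat.

Definition is_mul (c : step) : bool := if c is Mul _ _ then true else false.

Definition step_ok (m : nat) (c : step) : bool :=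
  match c with
  | Add i j | Sub i j | Mul i j => (i < m) && (j < m)
  | Neg i => i < m
  end%N.

Definition step_val (R : nzRingType) (mem : seq R) (c : step) : R :=
  match c with
  | Add i j => mem`_i + mem`_j
  | Sub i j => mem`_i - mem`_j
  | Neg i => - mem`_i
  | Mul i j => mem`_i * mem`_j
  end.

Fixpoint slp_ok (m : nat) (p : seq step) : bool :=
  if p is c :: p' then step_ok m c && slp_ok m.+1 p' else true.

Fixpoint slp_run (R : nzRingType) (mem : seq R) (p : seq step) : seq R :=
  if p is c :: p' then slp_run (rcons mem (step_val mem c)) p' else mem.

(* Main.v *)
Require Import Defs.
From mathcomp Require Import all_boot all_order all_fingroup all_algebra all_field.
From mathcomp Require Import ring.
From HB Require Import structures.

(* Write alpha = A(r) and beta = B(r) with A, B of degree at most 2 over K[s],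
   K the base field.  The product polynomial C = AB has degree 4, so it is
   determined by its values at the five points 1, -1, s, -s and infinity of the
   projective line over F_9.  Multiplication by s only swaps and negates
   coordinates, and since the four finite points are the fourth roots of unity
   and 4 = 1, interpolation is an inverse Fourier transform without division.
   Each of the five products in K[s] costs 3 multiplications by Karatsuba.
   The reduction by r^3 = r + 1 is free. *)

Import GRing.Theory.
Local Open Scope ring_scope.

Lemma nth_map_rmorph (R S : nzRingType) (f : {rmorphism R -> S}) (mem : seq R) i :
  [seq f x | x <- mem]`_i = f mem`_i.
Proof.
have [lt_i|ge_i] := ltnP i (size mem); first exact: nth_map.
by rewrite !nth_default ?size_map ?rmorph0.
Qed.

(** Programs use only ring operations and no constants, so a run over the base field can be carried
    into the extension, where [s] and [r] live. *)
Lemma slp_run_map (R S : nzRingType) (f : {rmorphism R -> S}) (mem : seq R) p :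
  [seq f x | x <- slp_run mem p] = slp_run [seq f x | x <- mem] p.
Proof.
elim: p mem => //= c p IH mem; rewrite IH map_rcons; congr (slp_run (rcons _ _) p).
by case: c => [i j|i j|i|i j] /=;
  rewrite !nth_map_rmorph ?rmorphD ?rmorphB ?rmorphN ?rmorphM.
Qed.

(* The first step is at position m; the product x * y in K[s] is found at
   positions m + 5 (coordinate of 1) and m + 7 (coordinate of s). *)
Definition karatsuba (m x0 x1 y0 y1 : nat) : seq step :=
  [:: Mul x0 y0; Mul x1 y1; Add x0 x1; Add y0 y1; Mul (m + 2) (m + 3);
      Defs.Sub m (m + 1); Defs.Sub (m + 4) m; Defs.Sub (m + 6) (m + 1)]%N.

(* Values at 1, -1, s, -s of A are at 16, 18, 20, 22 and of B at 28, 30, 32, 34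
   (each followed by its s-coordinate); the five products start at 36 (infinity),
   44, 52, 60, 68.  The last block interpolates and reduces at once: with E_x the
   value of C at x, the coefficients of 1, r, r^2 in alpha * beta are
   E_s + E_-s - E_1 - E_oo + s (E_s - E_-s), E_oo + E_-1 - E_1 and
   E_oo + E_1 + E_-1 - E_s - E_-s.
   [Sub] unqualified would be the constructor of subtypes. *)
Definition mul6_prog : seq step :=
  [:: Add 0 4; Add 1 5; Defs.Sub 0 4; Defs.Sub 1 5; Add 12 2; Add 13 3; Defs.Sub 12 2; Defs.Sub 13 3;
      Defs.Sub 14 3; Add 15 2; Add 14 3; Defs.Sub 15 2;
      Add 6 10; Add 7 11; Defs.Sub 6 10; Defs.Sub 7 11; Add 24 8; Add 25 9; Defs.Sub 24 8; Defs.Sub 25 9;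
      Defs.Sub 26 9; Add 27 8; Add 26 9; Defs.Sub 27 8]
  ++ karatsuba 36 4 5 10 11
  ++ karatsuba 44 16 17 28 29
  ++ karatsuba 52 18 19 30 31
  ++ karatsuba 60 20 21 32 33
  ++ karatsuba 68 22 23 34 35
  ++ [:: Add 65 73; Add 67 75; Defs.Sub 65 73; Defs.Sub 67 75; Add 41 49; Add 43 51;
         Defs.Sub 76 80; Defs.Sub 77 81; Defs.Sub 82 79; Add 83 78;
         Add 41 57; Add 43 59; Defs.Sub 86 49; Defs.Sub 87 51;
         Add 80 57; Add 81 59; Defs.Sub 90 76; Defs.Sub 91 77].

Definition mul6_out : 6.-tuple nat := [tuple 84; 85; 88; 89; 92; 93]%N.

Lemma mul6_progE (R : comNzRingType) (s r : R)
    (a0 a1 a2 a3 a4 a5 b0 b1 b2 b3 b4 b5 : R) :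
  3%:R = 0 :> R -> s ^+ 2 = - 1 -> r ^+ 3 = r + 1 ->
  let d i :=
    (slp_run [:: a0; a1; a2; a3; a4; a5; b0; b1; b2; b3; b4; b5] mul6_prog)`_i in
  d 84%N + d 85%N * s + d 88%N * r + d 89%N * (r * s)
    + d 92%N * r ^+ 2 + d 93%N * (r ^+ 2 * s) =
  (a0 + a1 * s + a2 * r + a3 * (r * s) + a4 * r ^+ 2 + a5 * (r ^+ 2 * s)) *
  (b0 + b1 * s + b2 * r + b3 * (r * s) + b4 * r ^+ 2 + b5 * (r ^+ 2 * s)).
Proof.
move=> three0 s2 r3 d; apply/esym/subr0_eq.
(* [/=] blows up here. *)
cbv [d slp_run mul6_prog karatsuba cat rcons step_val nth addn addn_rec Nat.add].
(* The outputs agree with the product only modulo 3; the discrepancy is explicit. *)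
pose A0 := a0 + a1 * s; pose A1 := a2 + a3 * s; pose A2 := a4 + a5 * s.
pose B0 := b0 + b1 * s; pose B1 := b2 + b3 * s; pose B2 := b4 + b5 * s.
pose c1 := A0 * B1 + A1 * B0; pose c2 := A0 * B2 + A1 * B1 + A2 * B0.
pose c3 := A1 * B2 + A2 * B1.
transitivity (3%:R * (c1 + c2 + (c1 + c3) * r - c2 * r ^+ 2)).
  rewrite /c1 /c2 /c3 /A0 /A1 /A2 /B0 /B1 /B2.
  ring: s2 r3.
by rewrite three0 mul0r.
Qed.

(** An irreducible [p] is coprime to any nonzero [q] of smaller degree, and coprimality survives
    extension of scalars, which excludes a common root. *)
Lemma root_irreducible_eq0 (F E : fieldType) (f : {rmorphism F -> E})
    (p q : {poly F}) (x : E) :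
  irreducible_poly p -> root (map_poly f p) x -> root (map_poly f q) x ->
  (size q < size p)%N -> q = 0.
Proof.
move=> irr_p px qx lt_qp; apply/eqP; apply: contraTT qx => q0.
have co_pq : coprimep p q by rewrite irreducible_poly_coprime // gtNdvdp.
by rewrite rootE; apply: coprimep_root px; rewrite coprimep_map.
Qed.

Lemma quadratic_free (F E : fieldType) (f : {rmorphism F -> E}) (s : E) (u v : F) :
  irreducible_poly ('X^2 + 1 : {poly F}) -> root ('X^2 + 1) s ->
  f u + f v * s = 0 -> u = 0 /\ v = 0.
Proof.
move=> irr hs uv0; have q0 : Poly [:: u; v] = 0.
  apply: (root_irreducible_eq0 _ _ f _ _ s irr).
  - by rewrite rmorphD rmorph1 /= map_polyXn.
  - by rewrite rootE map_Poly ?rmorph0 // horner_Poly /= mul0r add0r addrC uv0.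
  rewrite (leq_ltn_trans (size_Poly _)) //.
  by rewrite size_polyDl size_polyXn // size_poly1.
by split; [have := coef_Poly [:: u; v] 0 | have := coef_Poly [:: u; v] 1];
  rewrite q0 coef0.
Qed.

Lemma cubic_free (F E : fieldType) (f : {rmorphism F -> E}) (r : E) (u v w : F) :
  irreducible_poly ('X^3 - 'X - 1 : {poly F}) -> root ('X^3 - 'X - 1) r ->
  f u + f v * r + f w * r ^+ 2 = 0 -> [/\ u = 0, v = 0 & w = 0].
Proof.
move=> irr hr uvw0; have q0 : Poly [:: u; v; w] = 0.
  apply: (root_irreducible_eq0 _ _ f _ _ r irr).
  - by rewrite !rmorphB rmorph1 /= map_polyXn map_polyX.
  - rewrite rootE map_Poly ?rmorph0 // horner_Poly /=; apply/eqP.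
    by rewrite -[RHS]uvw0; ring.
  rewrite (leq_ltn_trans (size_Poly _)) //.
  by rewrite -addrA -opprD size_polyDl ?size_polyN size_polyXn // -polyC1 size_XaddC.
by split; [have := coef_Poly [:: u; v; w] 0 | have := coef_Poly [:: u; v; w] 1
  | have := coef_Poly [:: u; v; w] 2]; rewrite q0 coef0.
Qed.

Section Tower.
Variables (F K L : fieldType) (f : {rmorphism F -> K}) (g : {rmorphism K -> L}).
Variables (s : K) (r : L).
Hypotheses (irr_s : irreducible_poly ('X^2 + 1 : {poly F})) (hs : root ('X^2 + 1) s).
Hypotheses (irr_r : irreducible_poly ('X^3 - 'X - 1 : {poly K})).
Hypothesis (hr : root ('X^3 - 'X - 1) r).

Definition tower_comb (a : seq F) : L :=
  let k x := g (f x) in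
  k a`_0 + k a`_1 * g s + k a`_2 * r + k a`_3 * (r * g s)
    + k a`_4 * r ^+ 2 + k a`_5 * (r ^+ 2 * g s).

(** Freeness of 1, [r], [r ^+ 2] over [K], then of 1, [s] over [F]; hence outputs may be compared in
    [L]. *)
Lemma tower_comb_inj (a b : seq F) :
  size a = 6 -> size b = 6 -> tower_comb a = tower_comb b -> a = b.
Proof.
case: a => [|a0 [|a1 [|a2 [|a3 [|a4 [|a5 [|? ?]]]]]]] // _.
case: b => [|b0 [|b1 [|b2 [|b3 [|b4 [|b5 [|? ?]]]]]]] // _.
rewrite /tower_comb /= => eq_ab.
pose A (x x' y y' : F) := f (x - y) + f (x' - y') * s.
have A0 x x' y y' : A x x' y y' = 0 -> x = y /\ x' = y'.
  by case/(quadratic_free _ _ f _ _ _ irr_s hs) => /subr0_eq-> /subr0_eq->.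
have [] : [/\ A a0 a1 b0 b1 = 0, A a2 a3 b2 b3 = 0 & A a4 a5 b4 b5 = 0].
  apply: (cubic_free _ _ g _ _ _ _ irr_r hr).
  by move/eqP: eq_ab; rewrite -subr_eq0 => /eqP <-; rewrite /A; ring.
by move=> /A0[-> ->] /A0[-> ->] /A0[-> ->].
Qed.

Lemma mul6_prog_correct (a b c : seq F) :
  3%:R = 0 :> L -> size a = 6 -> size b = 6 -> size c = 6 ->
  tower_comb a * tower_comb b = tower_comb c ->
  [seq (slp_run (a ++ b) mul6_prog)`_i | i <- mul6_out] = c.
Proof.
move=> three0 sza szb szc abc; apply: tower_comb_inj; rewrite ?size_map //.
rewrite -abc.
have gs2 : g s ^+ 2 = -1.
  move/rootP: hs; rewrite !hornerE => /eqP; rewrite addr_eq0 => /eqP s2.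
  by rewrite -rmorphXn /= s2 rmorphN1.
have r3 : r ^+ 3 = r + 1.
  by move/rootP: hr; rewrite !hornerE -addrA -opprD => /subr0_eq.
have out_comb mem : tower_comb [seq mem`_i | i <- mul6_out] =
    let d i := [seq g (f x) | x <- mem]`_i in
    d 84%N + d 85%N * g s + d 88%N * r + d 89%N * (r * g s)
      + d 92%N * r ^+ 2 + d 93%N * (r ^+ 2 * g s).
  by rewrite /= !(nth_map_rmorph _ _ (g \o f)).
(* The run now takes place in [L], where [mul6_progE] applies. *)
rewrite out_comb (slp_run_map _ _ (g \o f)).
case: a sza {abc} => [|a0 [|a1 [|a2 [|a3 [|a4 [|a5 [|? ?]]]]]]] // _.
case: b szb => [|b0 [|b1 [|b2 [|b3 [|b4 [|b5 [|? ?]]]]]]] // _.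
exact: mul6_progE.
Qed.

End Tower.

HB.instance Definition _ := GRing.RMorphism.copy incl2 (qpolyC quadratic97).
HB.instance Definition _ := GRing.RMorphism.copy incl6 (qpolyC cubic194).

Theorem theorem1 (s : F3_194) (r : F3_582)
    (hs : root ('X^2 + 1) s) (hr : root ('X^3 - 'X - 1) r) :
  exists (p : seq step) (out : 6.-tuple nat),
    [/\ slp_ok 12 p,
        all (fun i => i < 12 + size p)%N out,
        (count is_mul p <= 15)%N
      & forall a b c : 6.-tuple F3_97,
          comb6 s r a * comb6 s r b = comb6 s r c ->
          [seq (slp_run (a ++ b) p)`_i | i <- out] = c].
Proof.
exists mul6_prog, mul6_out; split=> // a b c abc.
apply: (mul6_prog_correct _ _ _ incl2 incl6 s r quadratic97_mi.1 hs
  cubic194_mi.1 hr _ _ _ _ (size_tuple a) (size_tuple b) (size_tuple c) abc).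
have F3 : 3 \in [pchar F3_582].
  by rewrite !pchar_lalg pchar_Fp.
exact: pcharf0 F3.
Qed.
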